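(* Let $\mathcal{M},s$ and $\mathcal{M}',s'$ be pointed dependence epistemic models (over the same $\mathbb{P},\mathbb{V}$). Let $\mathcal{D}$ be either $\mathcal{D}_g$ (with $\mathfrak{G}=\mathfrak{G}_g$) or $\mathcal{D}_l$ (with $\mathfrak{G}=\mathfrak{G}_l$). Then $\mathcal{M},s$ and $\mathcal{M}',s'$ satisfy exactly the same formulas $\mathcal{D}(X,Y)$ for all finite $X,Y\subseteq\mathbb{V}$ if and only if $\mathfrak{G}(s)=\mathfrak{G}(s')$.
   Context: Fix a countable set $\mathbb{P}$ of propositions and a countable set $\mathbb{V}$ of variables. A dependence epistemic model is $\mathcal{M}=\langle S,T,V,U,\sim_i,\approx\rangle$ where $S$ is a set of worlds, $T:S\times\mathbb{P}\to\{0,1\}$, $V\supseteq\mathbb{V}$ is a countable set of variables, $U:S\times V\to\mathbb{N}$, and $\sim_i,\approx$ are equivalence relations on $S$. For $s,t\in S$ and $X\subseteq V$, write $X_s=X_t$ iff $U(s,x)=U(t,x)$ for all $x\in X$, and $X_s\neq X_t$ otherwise. Semantics (for finite $X,Y\subseteq\mathbb{V}$): $\mathcal{M},s\vDash\mathcal{D}_g(X,Y)$ iff there exist $u,v\in S$ with $u\approx v\approx s$, $(V\setminus(X\cup Y))_u=(V\setminus(X\cup Y))_v$, $X_u\neq X_v$ and $Y_u\neq Y_v$; $\mathcal{M},s\vDash\mathcal{D}_l(X,Y)$ iff there exists $t\in S$ with $t\approx s$, $(V\setminus(X\cup Y))_t=(V\setminus(X\cup Y))_s$, $X_t\neq X_s$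 and $Y_t\neq Y_s$. For $u,v\in S$, $\Delta(u,v)=\{x\in\mathbb{V}\mid U(u,x)\neq U(v,x)\}$ if $(V\setminus\mathbb{V})_u=(V\setminus\mathbb{V})_v$, and $\Delta(u,v)=\emptyset$ otherwise. $W$ is an evidence of $\langle X,Y\rangle$ iff $W\cap X\neq\emptyset$, $W\cap Y\neq\emptyset$, $W\subseteq X\cup Y$. $\mathcal{P}_g(s)=\{\Delta(u,v)\mid u,v\in S,\ u\approx v\approx s,\ \Delta(u,v)\text{ nonempty finite}\}$ and $\mathcal{P}_l(s)=\{\Delta(t,s)\mid t\in S,\ t\approx s,\ \Delta(t,s)\text{ nonempty finite}\}$. A nonempty finite $W\subseteq\mathbb{V}$ is generative from $\mathcal{P}(s)$ iff for all finite $X,Y\subseteq\mathbb{V}$ such that $W$ is an evidence of $\langle X,Y\rangle$, there is $W'\in\mathcal{P}(s)$ that is also an evidence of $\langle X,Y\rangle$. $\mathfrak{G}_g(s)$ (resp. $\mathfrak{G}_l(s)$) is the set of all nonempty finite $W\subseteq\mathbb{V}$ generative from $\mathcal{P}_g(s)$ (resp. $\mathcal{P}_l(s)$). *)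

(* Defs.v *)
From Stdlib Require Import RelationClasses.
From mathcomp Require Import all_boot all_classical.
Set Implicit Arguments.
Unset Strict Implicit.
Unset Printing Implicit Defensive.
Local Open Scope classical_set_scope.

(* [emb] renders the inclusion of the language variables [Var] into the
   possibly larger, model-dependent set [mvar] of variables. *)
Record model (Prp Var : countType) (Agent : Type) := Model {
  world : Type;
  truth : world -> Prp -> bool;
  mvar : countType;
  emb : Var -> mvar;
  emb_inj : injective emb;
  val_of : world -> mvar -> nat;
  sim : Agent -> world -> world -> Prop;
  sim_equiv : forall i, Equivalence (sim i);
  approx : world -> world -> Prop;
  approx_equiv : Equivalence approx
}.

Section Semantics.
Variables (Prp Var : countType) (Agent : Type) (M : model Prp Var Agent).
Implicit Types (s t u v : world M) (X Y : set Var).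

Definition agree (A : set (mvar M)) s t : Prop :=
  forall x, A x -> val_of s x = val_of t x.

Definition vars X : set (mvar M) := @emb _ _ _ M @` X.

Definition sat_Dg s X Y : Prop :=
  exists u v,
    [/\ approx u v /\ approx v s,
        agree (~` vars (X `|` Y)) u v,
        ~ agree (vars X) u v
      & ~ agree (vars Y) u v].

Definition sat_Dl s X Y : Prop :=
  exists t,
    [/\ approx t s,
        agree (~` vars (X `|` Y)) t s,
        ~ agree (vars X) t s
      & ~ agree (vars Y) t s].

Definition Delta u v : set Var :=
  if `[< agree (~` vars setT) u v >]
  then [set x | val_of u (emb M x) <> val_of v (emb M x)]
  else set0.

Definition Pg s : set (set Var) :=
  [set W | exists u v,
    [/\ approx u v /\ approx v s, W = Delta u v, W !=set0 & finite_set W]].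

Definition Pl s : set (set Var) :=
  [set W | exists t,
    [/\ approx t s, W = Delta t s, W !=set0 & finite_set W]].

End Semantics.

Definition evidence (Var : Type) (W X Y : set Var) : Prop :=
  [/\ W `&` X !=set0, W `&` Y !=set0 & W `<=` X `|` Y].

Definition generative (Var : Type) (P : set (set Var)) (W : set Var) : Prop :=
  forall X Y : set Var, finite_set X -> finite_set Y -> evidence W X Y ->
    exists W', P W' /\ evidence W' X Y.

Definition generative_sets (Var : Type) (P : set (set Var)) : set (set Var) :=
  [set W | [/\ W !=set0, finite_set W & generative P W]].

Definition Gg (Prp Var : countType) (Agent : Type) (M : model Prp Var Agent)
  (s : world M) : set (set Var) := generative_sets (Pg s).

Definition Gl (Prp Var : countType) (Agent : Type) (M : model Prp Var Agent)
  (s : world M) : set (set Var) := generative_sets (Pl s).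

(* Main.v *)
Require Import Defs.
From mathcomp Require Import all_boot all_classical.

(** The formula D(X, Y) holds at s exactly when some W in P(s) is an evidence of
    (X, Y), so the formulas true at s determine generativity from P(s).
    Conversely every member of P(s) is itself generative, hence any evidence in
    P(s) lies in G(s), and when G(s) = G(s') its generativity from P(s') yields
    an evidence there. *)

Local Open Scope classical_set_scope.

Section DifferenceSets.
Variables (Prp Var : countType) (Agent : Type) (M : model Prp Var Agent).
Implicit Types (s u v : world M) (X Y : set Var).

Lemma not_agree_varsP X u v :
  ~ agree (vars X) u v <->
  exists2 x, X x & val_of u (emb M x) <> val_of v (emb M x).
Proof.
split=> [nag|[x Xx neq] ag]; last by apply: neq; apply: ag; exists x.
apply: contrapT => nex; apply: nag => _ [x Xx <-].
by apply: contrapT => neq; apply: nex; exists x.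
Qed.

(** The default value of [Delta] is [set0], so a nonempty value certifies that the first branch was
    taken. *)
Lemma Delta_nonempty_agree u v :
  Delta u v !=set0 -> agree (~` vars setT) u v.
Proof. by rewrite /Delta; case: asboolP => // _ []. Qed.

Lemma in_DeltaE u v : agree (~` vars setT) u v ->
  Delta u v = [set x | val_of u (emb M x) <> val_of v (emb M x)].
Proof. by rewrite /Delta; case: asboolP. Qed.

(** Bridge between the semantic clauses, which speak of model variables, and [Delta], which only
    sees language variables; it serves the global and the local operator alike. *)
Lemma evidence_DeltaP u v X Y :
  [/\ agree (~` vars (X `|` Y)) u v, ~ agree (vars X) u v
    & ~ agree (vars Y) u v] <->
  evidence (Delta u v) X Y.
Proof.
split=> [[ag /not_agree_varsP[x Xx neqx] /not_agree_varsP[y Yy neqy]]|].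
  have agT : agree (~` vars setT) u v.
    by move=> m nm; apply: ag => -[z _ mE]; apply: nm; exists z.
  rewrite in_DeltaE //; split; [by exists x|by exists y|move=> z neqz].
  (* Were [z] outside both [X] and [Y], injectivity of [emb] would keep [emb M z] out of the image
     of their union, where [u] and [v] agree. *)
  apply: contrapT => nz; apply: neqz; apply: ag => -[z' XYz' zE].
  by apply: nz; rewrite -(emb_inj zE).
move=> [[x [Dx Xx]] [y [Dy Yy]] sub].
have agT : agree (~` vars setT) u v by apply: Delta_nonempty_agree; exists x.
rewrite in_DeltaE // in Dx Dy sub.
split; [|by apply/not_agree_varsP; exists x|by apply/not_agree_varsP; exists y].
(* Extra model variables are covered by [agT]; at the image of a language variable [z], a
   disagreement would put [z] in [Delta u v], hence in [X] or [Y]. *)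
move=> m nm; have [[z _ mE]|nT] := pselect (vars setT m); last exact: agT.
apply: contrapT => neq; apply: nm; exists z => //.
by apply: sub; rewrite /= mE.
Qed.

(** Supplies the side conditions for a difference set to belong to [Pg s] or [Pl s]. *)
Lemma evidence_nonempty_finite (W X Y : set Var) :
  finite_set X -> finite_set Y -> evidence W X Y -> W !=set0 /\ finite_set W.
Proof.
move=> finX finY [[x [Wx _]] _ sub]; split; first by exists x.
by apply: sub_finite_set sub _; rewrite finite_setU.
Qed.

Lemma sat_DgP s X Y : finite_set X -> finite_set Y ->
  sat_Dg s X Y <-> exists W, Pg s W /\ evidence W X Y.
Proof.
move=> finX finY; split=> [[u [v [uvs ag nX nY]]]|].
  have ev : evidence (Delta u v) X Y by apply/evidence_DeltaP.
  have [W0 finW] := evidence_nonempty_finite _ _ _ finX finY ev.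
  by exists (Delta u v); split=> //; exists u, v.
by case=> _ [[u [v [uvs -> _ _]]] /evidence_DeltaP[ag nX nY]]; exists u, v.
Qed.

Lemma sat_DlP s X Y : finite_set X -> finite_set Y ->
  sat_Dl s X Y <-> exists W, Pl s W /\ evidence W X Y.
Proof.
move=> finX finY; split=> [[t [ts ag nX nY]]|].
  have ev : evidence (Delta t s) X Y by apply/evidence_DeltaP.
  have [W0 finW] := evidence_nonempty_finite _ _ _ finX finY ev.
  by exists (Delta t s); split=> //; exists t.
by case=> _ [[t [ts -> _ _]] /evidence_DeltaP[ag nX nY]]; exists t.
Qed.

End DifferenceSets.

Lemma evidence_sub_generative_sets {Var : Type} (P P' : set (set Var)) :
    (forall W, P W -> W !=set0 /\ finite_set W) ->
    generative_sets P `<=` generative_sets P' ->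
  forall X Y, finite_set X -> finite_set Y ->
    (exists W, P W /\ evidence W X Y) -> exists W, P' W /\ evidence W X Y.
Proof.
move=> Pfin sub X Y finX finY [W [PW ev]].
have [W0 finW] := Pfin _ PW.
have [//|_ _ gen] := sub W; last exact: gen.
(* [W] is generative from [P] because it serves as its own witness. *)
by split=> // X' Y' _ _ ev'; exists W.
Qed.

Lemma generative_sets_sub_evidence {Var : Type} (P P' : set (set Var)) :
    (forall X Y, finite_set X -> finite_set Y ->
      (exists W, P W /\ evidence W X Y) -> exists W, P' W /\ evidence W X Y) ->
  generative_sets P `<=` generative_sets P'.
Proof.
move=> PP' W [W0 finW gen]; split=> // X Y finX finY ev.
by apply: PP' => //; apply: gen.
Qed.

(** Stated for arbitrary families of nonempty finite sets, so that the global and local cases are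
    two instances of one argument. *)
Lemma evidence_iff_generative_sets {Var : Type} (P P' : set (set Var)) :
    (forall W, P W -> W !=set0 /\ finite_set W) ->
    (forall W, P' W -> W !=set0 /\ finite_set W) ->
  (forall X Y, finite_set X -> finite_set Y ->
    ((exists W, P W /\ evidence W X Y) <-> exists W, P' W /\ evidence W X Y))
  <-> generative_sets P = generative_sets P'.
Proof.
move=> Pfin P'fin; split=> [iffP|eqG X Y finX finY].
  by apply/seteqP; split; apply: generative_sets_sub_evidence => X Y fX fY;
    case: (iffP X Y fX fY).
by split; apply: evidence_sub_generative_sets => //; rewrite eqG.
Qed.

Theorem mainTheorem4 (Prp Var : countType) (Agent : Type)
  (M M' : model Prp Var Agent) (s : world M) (s' : world M') :
  ((forall X Y : set Var, finite_set X -> finite_set Y ->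
      (sat_Dg s X Y <-> sat_Dg s' X Y))
    <-> Gg s = Gg s')
  /\
  ((forall X Y : set Var, finite_set X -> finite_set Y ->
      (sat_Dl s X Y <-> sat_Dl s' X Y))
    <-> Gl s = Gl s').
Proof.
have Pgfin (N : model Prp Var Agent) (r : world N) W :
  Pg r W -> W !=set0 /\ finite_set W by case=> u [v []].
have Plfin (N : model Prp Var Agent) (r : world N) W :
  Pl r W -> W !=set0 /\ finite_set W by case=> t [].
split.
- rewrite /Gg -(evidence_iff_generative_sets _ _ (Pgfin _ s) (Pgfin _ s')).
  by split=> H X Y fX fY; have := H X Y fX fY; rewrite !sat_DgP.
- rewrite /Gl -(evidence_iff_generative_sets _ _ (Plfin _ s) (Plfin _ s')).
  by split=> H X Y fX fY; have := H X Y fX fY; rewrite !sat_DlP.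
Qed.
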